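(* $E^{ce}_3\equiv_cZ^{ce}_0$, i.e. $E^{ce}_3\leq_cZ^{ce}_0$ and $Z^{ce}_0\leq_cE^{ce}_3$.
   Context: $W_e$ is the $e$-th c.e. set; $A^{[n]}=\{x:\langle x,n\rangle\in A\}$ is the $n$-th column of $A\subseteq\omega$. $i\,E^{ce}_3\,j\iff$ for every $n$, $W_i^{[n]}\triangle W_j^{[n]}$ is finite. $i\,Z^{ce}_0\,j\iff\lim_{n\to\infty}\frac{|(W_i\triangle W_j)\cap\{0,\dots,n-1\}|}{n}=0$. $E\leq_cF$ means there is a total computable $g$ with $x\,E\,y\iff g(x)\,F\,g(y)$ for all $x,y$. *)

(* Defs.v *)
From Stdlib Require Import Arith Lia Reals ClassicalEpsilon.

Definition cpair (x y : nat) : nat := (x + y) * (x + y + 1) / 2 + y.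

(* Syntax of (unary, via pairing) partial recursive function codes *)
Inductive prc : Type :=
| PZero : prc
| PSucc : prc
| PId   : prc
| PFst  : prc
| PSnd  : prc
| PComp : prc -> prc -> prc
| PPair : prc -> prc -> prc
| PRec  : prc -> prc -> prc
| PMu   : prc -> prc.

Inductive eval : prc -> nat -> nat -> Prop :=
| ev_zero x : eval PZero x 0
| ev_succ x : eval PSucc x (S x)
| ev_id x : eval PId x x
| ev_fst a b : eval PFst (cpair a b) a
| ev_snd a b : eval PSnd (cpair a b) b
| ev_comp f g x y z : eval g x y -> eval f y z -> eval (PComp f g) x z
| ev_pair f g x a b : eval f x a -> eval g x b -> eval (PPair f g) x (cpair a b)
| ev_rec0 f g a y : eval f a y -> eval (PRec f g) (cpair a 0) y
| ev_recS f g a n y z :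
    eval (PRec f g) (cpair a n) y -> eval g (cpair a (cpair n y)) z ->
    eval (PRec f g) (cpair a (S n)) z
| ev_mu f x n :
    eval f (cpair x n) 0 ->
    (forall m, m < n -> exists k, eval f (cpair x m) (S k)) ->
    eval (PMu f) x n.

Fixpoint encode (c : prc) : nat :=
  match c with
  | PZero => cpair 0 0
  | PSucc => cpair 1 0
  | PId => cpair 2 0
  | PFst => cpair 3 0
  | PSnd => cpair 4 0
  | PComp f g => cpair 5 (cpair (encode f) (encode g))
  | PPair f g => cpair 6 (cpair (encode f) (encode g))
  | PRec f g => cpair 7 (cpair (encode f) (encode g))
  | PMu f => cpair 8 (encode f)
  end.

(* phi_e : the e-th partial computable function (nowhere defined if e is
   not the code of a program). *)
Definition phi (e x y : nat) : Prop := exists c, encode c = e /\ eval c x y.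

Definition W (e : nat) (x : nat) : Prop := exists y, phi e x y.

Definition column (A : nat -> Prop) (n : nat) (x : nat) : Prop := A (cpair x n).

Definition symdiff (A B : nat -> Prop) (x : nat) : Prop :=
  (A x /\ ~ B x) \/ (B x /\ ~ A x).

Definition finite_set (A : nat -> Prop) : Prop := exists N, forall x, A x -> x < N.

Fixpoint count_below (A : nat -> Prop) (n : nat) : nat :=
  match n with
  | 0 => 0
  | S m => count_below A m +
           (if excluded_middle_informative (A m) then 1 else 0)
  end.

Definition E3ce (i j : nat) : Prop :=
  forall n, finite_set (symdiff (column (W i) n) (column (W j) n)).

Definition Z0ce (i j : nat) : Prop :=
  Un_cv (fun n => (INR (count_below (symdiff (W i) (W j)) n) / INR n)%R) 0%R.

Definition total_computable (g : nat -> nat) : Prop :=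
  exists c, forall x, eval c x (g x).

Definition creducible (E F : nat -> nat -> Prop) : Prop :=
  exists g, total_computable g /\ forall x y, E x y <-> F (g x) (g y).

(* Main.v *)
(** For [E3ce <= Z0ce], pull [W e] back along a computable [block : nat -> nat]
    under which each point of the [n]-th column has as preimage an interval
    [[2^m + 2^(m-n-1), 2^m + 2^(m-n))], i.e. a fixed proportion of an initial
    segment, while the columns beyond the [n]-th together have preimage of upper
    density at most [2^(1-n)].

    For [Z0ce <= E3ce], let [D b c] be the upper density of the symmetric difference
    of [W b] and [W c], a pseudometric. For each [r], join indices [b] and [c] by an
    edge when [D b c <= 2^-(r+b+c)]. Because the admissible distance shrinks with the
    index, a path without repetitions has length at most [2^(1-r)], so [Z0ce] is the
    intersection over [r] of the connectedness relations, each a Sigma_3 equivalence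
    relation. A Sigma_3 equivalence relation is coded into almost-equality of c.e.
    sets as follows: [p] ranges over finite guesses at a union of classes, the set
    attached to [e] contains [cpair p t] if [p] is refuted at level [t] (by a Pi_2
    edge separated by [p] and believed up to [t]), or if [p] contains [e] and [t]
    is the least level at which [p] is not refuted. If [e] and [f] are joined, all
    large guesses separating them are refuted at every level; if they are not
    connected, the guesses "class of [e]" give infinitely many differences. *)

Require Import Defs.
From Stdlib Require Import Arith Lia List Cantor Bool Reals Lra Classical ClassicalEpsilon.

(** * Cantor pairing and its projections *)

Lemma cpair_to_nat x y : cpair x y = to_nat (x, y).
Proof.
  unfold cpair.
  pose proof (to_nat_spec x y) as H.
  assert (E : (x + y) * (x + y + 1) = (to_nat (x, y) - y) * 2) by nia.
  rewrite E, Nat.div_mul by lia. nia.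
Qed.

Definition pl (z : nat) : nat := fst (of_nat z).
Definition pr (z : nat) : nat := snd (of_nat z).

Lemma pl_cpair x y : pl (cpair x y) = x.
Proof. unfold pl. now rewrite cpair_to_nat, cancel_of_to. Qed.

Lemma pr_cpair x y : pr (cpair x y) = y.
Proof. unfold pr. now rewrite cpair_to_nat, cancel_of_to. Qed.

Lemma cpair_pl_pr z : cpair (pl z) (pr z) = z.
Proof.
  rewrite cpair_to_nat. unfold pl, pr. rewrite <- surjective_pairing.
  apply cancel_to_of.
Qed.

Lemma cpair_inj a b c d : cpair a b = cpair c d -> a = c /\ b = d.
Proof.
  intro H. split.
  - now rewrite <- (pl_cpair a b), H, pl_cpair.
  - now rewrite <- (pr_cpair a b), H, pr_cpair.
Qed.

Lemma cpair_ge x y : x + y <= cpair x y.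
Proof. rewrite cpair_to_nat. pose proof (to_nat_non_decreasing x y). lia. Qed.

Ltac unpair := repeat first [rewrite pl_cpair in * | rewrite pr_cpair in *].

(** * Total computable functions *)

Notation tc := total_computable.

Lemma tc_ext f g : tc f -> (forall x, f x = g x) -> tc g.
Proof. intros [c Hc] E. exists c. intro x. rewrite <- E. apply Hc. Qed.

Lemma tc_id : tc (fun x => x).
Proof. exists PId. constructor. Qed.

Lemma tc_comp f g : tc f -> tc g -> tc (fun x => f (g x)).
Proof. intros [c Hc] [d Hd]. exists (PComp c d). intro x. now econstructor. Qed.

Lemma tc_succ f : tc f -> tc (fun x => S (f x)).
Proof. apply (tc_comp S). exists PSucc. constructor. Qed.

Lemma tc_const k : tc (fun _ => k).
Proof.
  induction k.
  - exists PZero. constructor.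
  - now apply (tc_succ (fun _ => k)).
Qed.

Lemma tc_pl f : tc f -> tc (fun x => pl (f x)).
Proof.
  apply (tc_comp pl). exists PFst. intro x.
  rewrite <- (cpair_pl_pr x) at 1. constructor.
Qed.

Lemma tc_pr f : tc f -> tc (fun x => pr (f x)).
Proof.
  apply (tc_comp pr). exists PSnd. intro x.
  rewrite <- (cpair_pl_pr x) at 1. constructor.
Qed.

Lemma tc_cpair f g : tc f -> tc g -> tc (fun x => cpair (f x) (g x)).
Proof. intros [c Hc] [d Hd]. exists (PPair c d). intro x. now constructor. Qed.

Definition natrec (a : nat) (G : nat -> nat -> nat) (n : nat) : nat :=
  nat_rect (fun _ => nat) a G n.

Lemma natrec_S a G n : natrec a G (S n) = G n (natrec a G n).
Proof. reflexivity. Qed.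

(** [G] is read off the triple [cpair x (cpair n y)] because that is the input [PRec] gives to its
    step program. *)
Lemma tc_rec f G h :
  tc f -> tc (fun z => G (pl z) (pl (pr z)) (pr (pr z))) -> tc h ->
  tc (fun x => natrec (f x) (G x) (h x)).
Proof.
  intros [c Hc] [d Hd] [e He].
  exists (PComp (PRec c d) (PPair PId e)). intro x.
  apply ev_comp with (cpair x (h x)).
  { constructor; [constructor | apply He]. }
  generalize (h x) as n. induction n as [|n IH]; simpl.
  - now constructor.
  - apply ev_recS with (natrec (f x) (G x) n); [exact IH|].
    specialize (Hd (cpair x (cpair n (natrec (f x) (G x) n)))).
    now rewrite !pr_cpair, !pl_cpair in Hd.
Qed.

Lemma tc_case f g h :
  tc f -> tc g -> tc h ->
  tc (fun x => match h x with 0 => f x | S _ => g x end).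
Proof.
  intros Hf Hg Hh.
  apply (tc_ext (fun x => natrec (f x) (fun _ _ => g x) (h x))).
  - apply tc_rec; trivial. apply (tc_comp g); trivial. apply tc_pl, tc_id.
  - intro x. now destruct (h x).
Qed.

Definition dec (P : nat -> bool) : Prop := tc (fun x => Nat.b2n (P x)).

Lemma dec_ext P Q : dec P -> (forall x, P x = Q x) -> dec Q.
Proof. intros HP E. apply (tc_ext _ _ HP). intro x. now rewrite E. Qed.

Lemma tc_if P f g :
  dec P -> tc f -> tc g -> tc (fun x => if P x then f x else g x).
Proof.
  intros HP Hf Hg.
  apply (tc_ext _ _ (tc_case g f _ Hg Hf HP)).
  intro x. now destruct (P x).
Qed.

Lemma dec_comp P f : dec P -> tc f -> dec (fun x => P (f x)).
Proof. intros HP. apply (tc_comp (fun x => Nat.b2n (P x))), HP. Qed.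

Lemma dec_const b : dec (fun _ => b).
Proof. apply (tc_const (Nat.b2n b)). Qed.

Lemma dec_if P Q R :
  dec P -> dec Q -> dec R -> dec (fun x => if P x then Q x else R x).
Proof.
  intros HP HQ HR. apply (tc_ext _ _ (tc_if P _ _ HP HQ HR)).
  intro x. now destruct (P x).
Qed.

Lemma dec_negb P : dec P -> dec (fun x => negb (P x)).
Proof. intro HP. exact (dec_if P _ _ HP (dec_const false) (dec_const true)). Qed.

Lemma dec_andb P Q : dec P -> dec Q -> dec (fun x => P x && Q x).
Proof. intros HP HQ. exact (dec_if P _ _ HP HQ (dec_const false)). Qed.

Lemma dec_orb P Q : dec P -> dec Q -> dec (fun x => P x || Q x).
Proof. intros HP HQ. exact (dec_if P _ _ HP (dec_const true) HQ). Qed.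

Lemma dec_xorb P Q : dec P -> dec Q -> dec (fun x => xorb (P x) (Q x)).
Proof.
  intros HP HQ.
  apply (dec_ext _ _ (dec_if P _ _ HP (dec_negb _ HQ) HQ)).
  intro x. now destruct (P x), (Q x).
Qed.

Definition bex (n : nat) (P : nat -> bool) : bool := existsb P (seq 0 n).
Definition ball (n : nat) (P : nat -> bool) : bool := forallb P (seq 0 n).

Lemma bex_true n P : bex n P = true <-> exists i, i < n /\ P i = true.
Proof.
  unfold bex. rewrite existsb_exists.
  split; intros (i & H & HP); exists i; rewrite in_seq in *; split; (lia || easy).
Qed.

Lemma ball_true n P : ball n P = true <-> forall i, i < n -> P i = true.
Proof.
  unfold ball. rewrite forallb_forall.
  split; intros H i Hi; apply H; rewrite in_seq in *; lia.
Qed.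

(** Trivial by unfolding, but as a hint it lets proof search pass from [tc] goals to [dec] goals. *)
Lemma tc_b2n P : dec P -> tc (fun x => Nat.b2n (P x)).
Proof. trivial. Qed.

Create HintDb tc.
#[local] Hint Resolve tc_id tc_const dec_const tc_succ tc_pl tc_pr tc_cpair
  tc_rec tc_if tc_b2n dec_if dec_negb dec_andb dec_orb dec_xorb : tc.
#[local] Hint Extern 1 (tc _) =>
  match goal with
  | H : tc ?f |- tc (fun x => ?f (@?g x)) => apply (tc_comp f g H)
  end : tc.
#[local] Hint Extern 1 (dec _) =>
  match goal with
  | H : dec ?f |- dec (fun x => ?f (@?g x)) => apply (dec_comp f g H)
  end : tc.

Ltac solve_tc := cbv beta; auto 60 with tc.

Lemma tc_pred f : tc f -> tc (fun x => pred (f x)).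
Proof.
  intro Hf. apply (tc_ext (fun x => natrec 0 (fun n _ => n) (f x))); [solve_tc|].
  intro x. now destruct (f x).
Qed.
#[local] Hint Resolve tc_pred : tc.

Lemma tc_add f g : tc f -> tc g -> tc (fun x => f x + g x).
Proof.
  intros. apply (tc_ext (fun x => natrec (g x) (fun _ r => S r) (f x))); [solve_tc|].
  intro x. induction (f x); simpl; auto.
Qed.
#[local] Hint Resolve tc_add : tc.

Lemma tc_sub f g : tc f -> tc g -> tc (fun x => f x - g x).
Proof.
  intros. apply (tc_ext (fun x => natrec (f x) (fun _ r => pred r) (g x))); [solve_tc|].
  intro x. induction (g x); simpl; lia.
Qed.
#[local] Hint Resolve tc_sub : tc.

Lemma tc_mul f g : tc f -> tc g -> tc (fun x => f x * g x).
Proof.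
  intros. apply (tc_ext (fun x => natrec 0 (fun _ r => g x + r) (f x))); [solve_tc|].
  intro x. induction (f x); simpl; auto.
Qed.
#[local] Hint Resolve tc_mul : tc.

Lemma tc_pow k f : tc f -> tc (fun x => k ^ f x).
Proof.
  intros. apply (tc_ext (fun x => natrec 1 (fun _ r => k * r) (f x))); [solve_tc|].
  intro x. induction (f x); simpl; auto.
Qed.
#[local] Hint Resolve tc_pow : tc.

Lemma dec_eq0 f : tc f -> dec (fun x => f x =? 0).
Proof.
  intros. apply (tc_ext (fun x => natrec 1 (fun _ _ => 0) (f x))); [solve_tc|].
  intro x. now destruct (f x).
Qed.
#[local] Hint Resolve dec_eq0 : tc.

Lemma dec_leb f g : tc f -> tc g -> dec (fun x => f x <=? g x).
Proof.
  intros. apply (dec_ext (fun x => f x - g x =? 0)); [solve_tc|].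
  intro x. apply eq_true_iff_eq. rewrite Nat.eqb_eq, Nat.leb_le. lia.
Qed.
#[local] Hint Resolve dec_leb : tc.

Lemma dec_ltb f g : tc f -> tc g -> dec (fun x => f x <? g x).
Proof. intros. unfold Nat.ltb. solve_tc. Qed.
#[local] Hint Resolve dec_ltb : tc.

Lemma dec_eqb f g : tc f -> tc g -> dec (fun x => f x =? g x).
Proof.
  intros. apply (dec_ext (fun x => (f x <=? g x) && (g x <=? f x))); [solve_tc|].
  intro x. apply eq_true_iff_eq.
  rewrite andb_true_iff, Nat.eqb_eq, !Nat.leb_le. lia.
Qed.
#[local] Hint Resolve dec_eqb : tc.

Lemma dec_bex h P :
  tc h -> dec (fun z => P (pl z) (pr z)) -> dec (fun x => bex (h x) (P x)).
Proof.
  intros Hh HP.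
  (* The recursion step sees the triple of parameter, counter and accumulator, so [P] has to be
     re-read at its first two entries. *)
  assert (HP3 : dec (fun z => P (pl z) (pl (pr z)))).
  { apply (dec_ext (fun z => P (pl (cpair (pl z) (pl (pr z))))
                              (pr (cpair (pl z) (pl (pr z)))))).
    - apply (dec_comp (fun z => P (pl z) (pr z)) (fun z => cpair (pl z) (pl (pr z))) HP).
      solve_tc.
    - intro z. now unpair. }
  apply (tc_ext (fun x => natrec 0 (fun i r => if P x i then 1 else r) (h x))).
  - solve_tc.
  - intro x. induction (h x) as [|n IH]; [reflexivity|]. simpl. rewrite IH.
    unfold bex. rewrite seq_S, existsb_app. simpl.
    now destruct (P x n), (existsb (P x) (seq 0 n)).
Qed.

Lemma dec_ball h P :
  tc h -> dec (fun z => P (pl z) (pr z)) -> dec (fun x => ball (h x) (P x)).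
Proof.
  intros Hh HP.
  apply (dec_ext (fun x => negb (bex (h x) (fun i => negb (P x i))))).
  - apply dec_negb, dec_bex; solve_tc.
  - intro x. apply eq_true_iff_eq.
    rewrite negb_true_iff, <- not_true_iff_false, bex_true, ball_true. split.
    + intros H i Hi. destruct (P x i) eqn:E; trivial. exfalso. apply H.
      exists i. now rewrite E.
    + intros H (i & Hi & E). now rewrite H in E.
Qed.
#[local] Hint Resolve dec_bex dec_ball : tc.

Lemma dec_odd f : tc f -> dec (fun x => Nat.odd (f x)).
Proof.
  intros. apply (tc_ext (fun x => natrec 0 (fun _ r => 1 - r) (f x))); [solve_tc|].
  intro x. induction (f x) as [|n IH]; [reflexivity|].
  rewrite Nat.odd_succ, <- Nat.negb_odd, natrec_S, IH. now destruct (Nat.odd n).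
Qed.
#[local] Hint Resolve dec_odd : tc.

Lemma tc_div2 f : tc f -> tc (fun x => Nat.div2 (f x)).
Proof.
  intros.
  apply (tc_ext (fun x => natrec 0 (fun n r => if Nat.odd n then S r else r) (f x)));
    [solve_tc|].
  intro x. induction (f x) as [|n IH]; [reflexivity|]. rewrite natrec_S, IH.
  pose proof (Nat.div2_odd n) as H1. pose proof (Nat.div2_odd (S n)) as H2.
  rewrite Nat.odd_succ, <- Nat.negb_odd in H2.
  destruct (Nat.odd n); simpl in H1, H2 |- *; lia.
Qed.
#[local] Hint Resolve tc_div2 : tc.

Lemma dec_testbit f g : tc f -> tc g -> dec (fun x => Nat.testbit (f x) (g x)).
Proof.
  intros.
  apply (dec_ext (fun x => Nat.odd (natrec (f x) (fun _ r => Nat.div2 r) (g x))));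
    [solve_tc|].
  intro x. generalize (f x) as a. induction (g x) as [|n IH]; intro a; [reflexivity|].
  simpl Nat.testbit. rewrite <- IH. f_equal. clear.
  induction n as [|n IH]; simpl in *; [reflexivity|]. now rewrite IH.
Qed.
#[local] Hint Resolve dec_testbit : tc.

(** Counting upwards, the logarithm grows by one exactly on reaching a new power of two. *)
Lemma tc_log2 f : tc f -> tc (fun x => Nat.log2 (f x)).
Proof.
  intros.
  apply (tc_ext (fun x =>
    natrec 0 (fun n r => if 2 ^ S r =? S n then S r else r) (f x))); [solve_tc|].
  intro x. induction (f x) as [|n IH]; [reflexivity|]. rewrite natrec_S, IH.
  destruct n as [|n]; [reflexivity|].
  pose proof (Nat.log2_spec (S n) ltac:(lia)) as [H1 H2].
  destruct (Nat.eqb_spec (2 ^ S (Nat.log2 (S n))) (S (S n))) as [E|E].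
  - now rewrite <- E, Nat.log2_pow2 by lia.
  - symmetry. apply Nat.log2_unique; lia.
Qed.
#[local] Hint Resolve tc_log2 : tc.
(** * A universal machine *)

(* Finite sets of numbers are coded by their characteristic bits. *)
Definition insert (z F : nat) : nat := if Nat.testbit F z then F else F + 2 ^ z.

Lemma testbit_insert z F w :
  Nat.testbit (insert z F) w = (z =? w) || Nat.testbit F w.
Proof.
  unfold insert. destruct (Nat.testbit F z) eqn:E.
  - destruct (Nat.eqb_spec z w) as [->|]; [now rewrite E|reflexivity].
  (* Bit [z] of [F] is clear, so the addition carries nothing and acts as a bitwise exclusive or. *)
  - rewrite Nat.add_nocarry_lxor.
    + rewrite Nat.lxor_spec, Nat.pow2_bits_eqb.
      destruct (Nat.eqb_spec z w) as [->|]; [now rewrite E|].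
      now destruct (Nat.testbit F w).
    + apply Nat.bits_inj_0. intro n. rewrite Nat.land_spec, Nat.pow2_bits_eqb.
      destruct (Nat.eqb_spec z n) as [->|]; [now rewrite E|apply andb_false_r].
Qed.

(* The two kinds of facts the machine derives: "c is the code of a program"
   and "program c on input x outputs y". The former is needed because
   a recursion stopping at [ev_rec0] never runs its second subprogram. *)
Definition fcode (c : nat) : nat := cpair 0 c.
Definition feval (c x y : nat) : nat := cpair 1 (cpair c (cpair x y)).

Definition code_rule (F c : nat) : bool :=
  let t := pl c in let r := pr c in
  (t <=? 4) && (r =? 0)
  || (5 <=? t) && (t <=? 7)
     && (Nat.testbit F (fcode (pl r)) && Nat.testbit F (fcode (pr r)))
  || (t =? 8) && Nat.testbit F (fcode r).

(** Intermediate values are sought below the stage [s], which keeps the rule decidable and loses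
    nothing as [s] grows. *)
Definition eval_rule (s F c x y : nat) : bool :=
  let t := pl c in let r := pr c in
  (t =? 0) && (r =? 0) && (y =? 0)
  || (t =? 1) && (r =? 0) && (y =? S x)
  || (t =? 2) && (r =? 0) && (y =? x)
  || (t =? 3) && (r =? 0) && (y =? pl x)
  || (t =? 4) && (r =? 0) && (y =? pr x)
  || (t =? 5) && bex s (fun m => Nat.testbit F (feval (pr r) x m)
                                 && Nat.testbit F (feval (pl r) m y))
  || (t =? 6) && (Nat.testbit F (feval (pl r) x (pl y))
                  && Nat.testbit F (feval (pr r) x (pr y)))
  || (t =? 7) && (pr x =? 0) && (Nat.testbit F (fcode (pr r))
                  && Nat.testbit F (feval (pl r) (pl x) y))
  || (t =? 7) && (0 <? pr x)
     && bex s (fun m =>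
          Nat.testbit F (feval c (cpair (pl x) (pred (pr x))) m)
          && Nat.testbit F (feval (pr r) (cpair (pl x) (cpair (pred (pr x)) m)) y))
  || (t =? 8) && (Nat.testbit F (feval r (cpair x y) 0)
     && ball y (fun m => bex s (fun k => Nat.testbit F (feval r (cpair x m) (S k))))).

Definition rule (s F z : nat) : bool :=
  (pl z =? 0) && code_rule F (pr z)
  || (pl z =? 1) && eval_rule s F (pl (pr z)) (pl (pr (pr z))) (pr (pr (pr z))).

(* Stage [s] tries to derive the single fact [pl s], so that every fact is
   tried infinitely often. *)
Definition facts (s : nat) : nat :=
  natrec 0 (fun s F => if rule s F (pl s) then insert (pl s) F else F) s.

Lemma dec_rule s F z :
  tc s -> tc F -> tc z -> dec (fun x => rule (s x) (F x) (z x)).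
Proof.
  intros. unfold rule, code_rule, eval_rule, fcode, feval. cbv zeta. solve_tc.
Qed.
#[local] Hint Resolve dec_rule : tc.

Lemma tc_facts s : tc s -> tc (fun x => facts (s x)).
Proof. intros. unfold facts, insert. solve_tc. Qed.
#[local] Hint Resolve tc_facts : tc.

Definition true_fact (z : nat) : Prop :=
  (pl z = 0 /\ exists c, encode c = pr z) \/
  (pl z = 1 /\ phi (pl (pr z)) (pl (pr (pr z))) (pr (pr (pr z)))).

Lemma true_fcode c : true_fact (fcode c) <-> exists d, encode d = c.
Proof. unfold true_fact, fcode. unpair. intuition (auto; discriminate). Qed.

Lemma true_feval c x y : true_fact (feval c x y) <-> phi c x y.
Proof. unfold true_fact, feval. unpair. intuition (auto; discriminate). Qed.

(** Facts mention only codes; injectivity ensures that separate facts about one code concern the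
    same program. *)
Lemma encode_inj c d : encode c = encode d -> c = d.
Proof.
  revert d. induction c; intros d H; destruct d; simpl in H;
    apply cpair_inj in H as [Ht H]; try discriminate; trivial;
    try (apply cpair_inj in H as [H1 H2]); f_equal; auto.
Qed.

Lemma phi_encode c x y : phi (encode c) x y <-> eval c x y.
Proof.
  split.
  - intros (d & E & H). now rewrite <- (encode_inj _ _ E).
  - now exists c.
Qed.

Ltac split_bool :=
  repeat match goal with
  | H : _ || _ = true |- _ => apply orb_true_iff in H as [H|H]
  | H : _ && _ = true |- _ => apply andb_true_iff in H as [H ?]
  | H : (_ =? _) = true |- _ => apply Nat.eqb_eq in H
  | H : (_ <=? _) = true |- _ => apply Nat.leb_le in H
  | H : (_ <? _) = true |- _ => apply Nat.ltb_lt in H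
  end.

Lemma code_rule_sound F c :
  (forall z, Nat.testbit F z = true -> true_fact z) ->
  code_rule F c = true -> exists d, encode d = c.
Proof.
  intros HF H. unfold code_rule in H. rewrite <- (cpair_pl_pr c).
  set (t := pl c) in *. set (r := pr c) in *. clearbody t r. split_bool.
  - subst r. destruct t as [|[|[|[|[|t]]]]]; [| | | | |lia];
      [now exists PZero|now exists PSucc|now exists PId|now exists PFst|now exists PSnd].
  - match goal with
    | H1 : Nat.testbit F (fcode (pl r)) = true,
      H2 : Nat.testbit F (fcode (pr r)) = true |- _ =>
      apply HF, true_fcode in H1 as [f Hf]; apply HF, true_fcode in H2 as [g Hg]
    end.
    rewrite <- (cpair_pl_pr r), <- Hf, <- Hg.
    destruct t as [|[|[|[|[|[|[|[|t]]]]]]]]; try lia;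
      [now exists (PComp f g)|now exists (PPair f g)|now exists (PRec f g)].
  - match goal with
    | H1 : Nat.testbit F _ = true |- _ => apply HF, true_fcode in H1 as [f Hf]
    end.
    subst. now exists (PMu f).
Qed.

Lemma eval_rule_sound s F c x y :
  (forall z, Nat.testbit F z = true -> true_fact z) ->
  eval_rule s F c x y = true -> phi c x y.
Proof.
  intros HF H.
  assert (HE : forall c x y, Nat.testbit F (feval c x y) = true -> phi c x y)
    by (intros; now apply true_feval, HF).
  assert (K : forall d, encode d = cpair (pl c) (pr c) -> eval d x y -> phi c x y)
    by (intros d Ed Hd; exists d; now rewrite cpair_pl_pr in Ed).
  unfold eval_rule in H. cbv zeta in H. split_bool.
  - apply (K PZero); [simpl; congruence|subst; constructor].
  - apply (K PSucc); [simpl; congruence|subst; constructor].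
  - apply (K PId); [simpl; congruence|subst; constructor].
  - apply (K PFst); [simpl; congruence|subst y].
    rewrite <- (cpair_pl_pr x) at 1. constructor.
  - apply (K PSnd); [simpl; congruence|subst y].
    rewrite <- (cpair_pl_pr x) at 1. constructor.
  - match goal with H : bex _ _ = true |- _ => apply bex_true in H as (m & _ & H') end.
    apply andb_true_iff in H' as [H1 H2].
    apply HE in H1 as (g & Eg & H1). apply HE in H2 as (f & Ef & H2).
    exists (PComp f g). split; [|now apply ev_comp with m].
    simpl. now rewrite Ef, Eg, cpair_pl_pr, <- H, cpair_pl_pr.
  - match goal with
    | H1 : Nat.testbit F (feval (pr (pr c)) _ _) = true,
      H2 : Nat.testbit F (feval (pl (pr c)) _ _) = true |- _ =>
      apply HE in H1 as (g & Eg & H1); apply HE in H2 as (f & Ef & H2);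
      exists (PPair f g); split; [|rewrite <- (cpair_pl_pr y); now constructor] end.
    simpl. now rewrite Ef, Eg, cpair_pl_pr, <- H, cpair_pl_pr.
  - match goal with
    | H1 : Nat.testbit F (feval _ _ _) = true,
      H2 : Nat.testbit F (fcode _) = true, E : pr x = 0 |- _ =>
      apply HE in H1 as (f & Ef & H1); apply HF, true_fcode in H2 as (g & Eg);
      exists (PRec f g); split;
      [|rewrite <- (cpair_pl_pr x), E; now constructor] end.
    simpl. now rewrite Ef, Eg, cpair_pl_pr, <- H, cpair_pl_pr.
  - match goal with H : bex _ _ = true |- _ => apply bex_true in H as (m & _ & H') end.
    apply andb_true_iff in H' as [H3 H4].
    apply HE in H3 as (d & Ed & H3). apply HE in H4 as (g & Eg & H4).
    exists d. split; [exact Ed|].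
    (* The tag 7 forces [d] to be a recursion, and injectivity identifies its step program with
       [g]. *)
    assert (exists f, d = PRec f g) as [f ->].
    { rewrite <- (cpair_pl_pr c), H in Ed.
      destruct d; simpl in Ed; apply cpair_inj in Ed as [? Ed]; try discriminate.
      rewrite <- (cpair_pl_pr (pr c)) in Ed. apply cpair_inj in Ed as [_ Ed].
      rewrite <- Eg in Ed. apply encode_inj in Ed. subst. eauto. }
    rewrite <- (cpair_pl_pr x). destruct (pr x) as [|n]; [lia|].
    now apply ev_recS with m.
  - match goal with
    | H1 : Nat.testbit F _ = true, H2 : ball _ _ = true |- _ =>
      apply HE in H1 as (f & Ef & H1); rewrite ball_true in H2;
      exists (PMu f); split; [|constructor; [exact H1|intros m Hm]];
      [|apply H2 in Hm] end.
    + simpl. now rewrite Ef, <- H, cpair_pl_pr.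
    + apply bex_true in Hm as (k & _ & Hk). apply HE in Hk as (f' & Ef' & Hk).
      rewrite <- Ef in Ef'. apply encode_inj in Ef'. subst. eauto.
Qed.

Lemma facts_S s :
  facts (S s) = if rule s (facts s) (pl s) then insert (pl s) (facts s) else facts s.
Proof. reflexivity. Qed.

Lemma facts_sound s z : Nat.testbit (facts s) z = true -> true_fact z.
Proof.
  revert z. induction s as [|s IH]; intro z.
  - now rewrite Nat.bits_0.
  - rewrite facts_S. destruct (rule s (facts s) (pl s)) eqn:E; [|apply IH].
    rewrite testbit_insert, orb_true_iff, Nat.eqb_eq. intros [<-|H]; [|now apply IH].
    unfold rule in E. split_bool; [left|right]; (split; [assumption|]).
    + eapply code_rule_sound; eassumption.
    + eapply eval_rule_sound; eassumption.
Qed.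

Lemma facts_mono s s' z :
  s <= s' -> Nat.testbit (facts s) z = true -> Nat.testbit (facts s') z = true.
Proof.
  intros Hs H. induction Hs as [|s' _ IH]; trivial.
  rewrite facts_S. destruct (rule _ _ _); trivial.
  rewrite testbit_insert, IH. apply orb_true_r.
Qed.

(** * Completeness of the machine *)

Definition eventually (P : nat -> Prop) : Prop := exists s0, forall s, s0 <= s -> P s.

Lemma eventually_ge n : eventually (fun s => n <= s).
Proof. now exists n. Qed.

Lemma eventually_impl (P Q : nat -> Prop) :
  (forall s, P s -> Q s) -> eventually P -> eventually Q.
Proof. intros H [n HP]. exists n. auto. Qed.

Lemma eventually_and P Q :
  eventually P -> eventually Q -> eventually (fun s => P s /\ Q s).
Proof.
  intros [n HP] [m HQ]. exists (n + m). intros s Hs. split; [apply HP|apply HQ]; lia.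
Qed.

Lemma eventually_forall_lt n (P : nat -> nat -> Prop) :
  (forall i, i < n -> eventually (P i)) -> eventually (fun s => forall i, i < n -> P i s).
Proof.
  induction n as [|n IH]; intro H.
  - exists 0. lia.
  - apply (eventually_impl (fun s => (forall i, i < n -> P i s) /\ P n s)).
    + intros s [H1 H2] i Hi. destruct (Nat.eq_dec i n) as [->|]; [trivial|apply H1; lia].
    + apply eventually_and; [apply IH; auto|apply H; lia].
Qed.

Definition derived (z s : nat) : Prop := Nat.testbit (facts s) z = true.

(** Stage [cpair z s0] tries exactly the fact [z] and comes no earlier than [s0]. *)
Lemma derived_rule z :
  eventually (fun s => rule s (facts s) z = true) -> eventually (derived z).
Proof.
  intros [s0 H]. exists (S (cpair z s0)). intros s Hs.
  apply (facts_mono (S (cpair z s0))); trivial.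
  rewrite facts_S, pl_cpair, H.
  - now rewrite testbit_insert, Nat.eqb_refl.
  - pose proof (cpair_ge z s0). lia.
Qed.

Lemma derived_fcode c :
  eventually (fun s => code_rule (facts s) c = true) -> eventually (derived (fcode c)).
Proof.
  intro H. apply derived_rule.  revert H. apply eventually_impl. intros s H.
  unfold rule, fcode. unpair. now rewrite H.
Qed.

Lemma derived_feval c x y :
  eventually (fun s => eval_rule s (facts s) c x y = true) ->
  eventually (derived (feval c x y)).
Proof.
  intro H. apply derived_rule. revert H. apply eventually_impl. intros s H.
  unfold rule, feval. unpair. now rewrite H.
Qed.

Lemma code_complete c : eventually (derived (fcode (encode c))).
Proof.
  induction c;
    try (apply derived_fcode; exists 0; intros s _; unfold code_rule; simpl encode;
         now unpair);
    apply derived_fcode;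
    repeat match goal with
    | H1 : eventually _, H2 : eventually _ |- _ =>
        pose proof (eventually_and _ _ H1 H2) as H; clear H1 H2
    end.
  1-3: revert H; apply eventually_impl; intros s [H1 H2];
    unfold code_rule, derived in *; simpl encode; unpair; now rewrite H1, H2.
  revert IHc. apply eventually_impl. intros s H.
  unfold code_rule, derived in *; simpl encode; unpair; now rewrite H.
Qed.

Lemma derived_comp f g x y z :
  eventually (derived (feval (encode g) x y)) ->
  eventually (derived (feval (encode f) y z)) ->
  eventually (derived (feval (encode (PComp f g)) x z)).
Proof.
  intros H1 H2. apply derived_feval.
  generalize (eventually_and _ _ (eventually_ge (S y)) (eventually_and _ _ H1 H2)).
  apply eventually_impl. unfold derived. intros s (Hy & Hg & Hf).
  unfold eval_rule. simpl encode. unpair. cbn [Nat.eqb andb orb].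
  rewrite (proj2 (bex_true _ _)); [reflexivity|].
  exists y. split; [lia|]. now rewrite Hg, Hf.
Qed.

Lemma derived_recS f g a n y z :
  eventually (derived (feval (encode (PRec f g)) (cpair a n) y)) ->
  eventually (derived (feval (encode g) (cpair a (cpair n y)) z)) ->
  eventually (derived (feval (encode (PRec f g)) (cpair a (S n)) z)).
Proof.
  intros H1 H2. apply derived_feval.
  generalize (eventually_and _ _ (eventually_ge (S y)) (eventually_and _ _ H1 H2)).
  apply eventually_impl. unfold derived. intros s (Hy & Hf & Hg).
  unfold eval_rule.
  change (encode (PRec f g)) with (cpair 7 (cpair (encode f) (encode g))) in *.
  unpair. cbn [Nat.eqb Nat.ltb Nat.leb Nat.pred andb orb].
  rewrite (proj2 (bex_true _ _)); [reflexivity|].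
  exists y. split; [lia|]. now rewrite Hf, Hg.
Qed.

Lemma derived_mu f x n :
  eventually (derived (feval (encode f) (cpair x n) 0)) ->
  (forall m, m < n ->
     exists k, eventually (derived (feval (encode f) (cpair x m) (S k)))) ->
  eventually (derived (feval (encode (PMu f)) x n)).
Proof.
  intros H1 H2. apply derived_feval.
  assert (H3 : eventually (fun s => forall m, m < n ->
    exists k, k < s /\ derived (feval (encode f) (cpair x m) (S k)) s)).
  { apply eventually_forall_lt. intros m Hm. destruct (H2 m Hm) as [k Hk].
    generalize (eventually_and _ _ (eventually_ge (S k)) Hk).
    apply eventually_impl. intros s Hs. now exists k. }
  generalize (eventually_and _ _ H1 H3).
  apply eventually_impl. unfold derived. intros s (H0 & Hlt).
  unfold eval_rule. simpl encode. unpair. cbn [Nat.eqb andb orb].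
  rewrite H0. apply ball_true. intros m Hm. now apply bex_true, Hlt.
Qed.

(** The induction is on the program, since [ev_mu] hides derivations under an existential
    quantifier; primitive recursion then needs an inner induction on its counter. *)
Lemma eval_complete c x y :
  eval c x y -> eventually (derived (feval (encode c) x y)).
Proof.
  revert x y. induction c as [| | | | |f IHf g IHg|f IHf g IHg|f IHf g IHg|f IHf];
    intros x y H.
  1-5: apply derived_feval; exists 0; intros s _; unfold eval_rule;
    inversion H; subst; simpl encode; unpair; cbn [Nat.eqb andb orb];
    now rewrite ?Nat.eqb_refl.
  - inversion H; subst. eapply derived_comp; eauto.
  - inversion H as [| | | | | |? ? ? a b Ha Hb| | |]; subst. apply derived_feval.
    generalize (eventually_and _ _ (IHf _ _ Ha) (IHg _ _ Hb)).
    apply eventually_impl. unfold derived. intros s [H1 H2].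
    unfold eval_rule. simpl encode. unpair. now rewrite H1, H2.
  - rewrite <- (cpair_pl_pr x) in *. revert y H.
    generalize (pl x) as a. induction (pr x) as [|n IH]; intros a y H;
      inversion H; subst;
      match goal with
      | E : cpair _ _ = cpair _ _ |- _ => apply cpair_inj in E as [-> E]
      end; try discriminate.
    + apply derived_feval.
      generalize (eventually_and _ _ (code_complete g) (IHf a y ltac:(assumption))).
      apply eventually_impl. unfold derived. intros s [H1 H2].
      unfold eval_rule. simpl encode. unpair. now rewrite H1, H2.
    + match goal with E : S _ = S _ |- _ => injection E as -> end.
      eapply derived_recS; eauto.
  - inversion H as [| | | | | | | | |? ? ? H0 Hlt]; subst. apply derived_mu; auto.
    intros m Hm. destruct (Hlt m Hm) as [k Hk]. exists k. auto.
Qed.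

(** * Stage approximations to c.e. sets and the s-m-n theorem *)

Definition Wst (e x s : nat) : bool :=
  bex s (fun y => Nat.testbit (facts s) (feval e x y)).

Lemma dec_Wst e x s : tc e -> tc x -> tc s -> dec (fun z => Wst (e z) (x z) (s z)).
Proof. intros. unfold Wst, feval. solve_tc. Qed.
#[local] Hint Resolve dec_Wst : tc.

Lemma Wst_sound e x s : Wst e x s = true -> W e x.
Proof.
  unfold Wst. rewrite bex_true. intros (y & _ & H). exists y.
  now apply true_feval, (facts_sound s).
Qed.

Lemma Wst_limit e x :
  eventually (fun s => Wst e x s = true <-> W e x).
Proof.
  destruct (classic (W e x)) as [[y (c & <- & H)]|H].
  - generalize (eventually_and _ _ (eventually_ge (S y)) (eval_complete _ _ _ H)).
    apply eventually_impl. intros s [Hs Hd]. unfold Wst. rewrite bex_true.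
    split; intro; [|now exists y]. exists y. now apply phi_encode.
  - exists 0. intros s _. split; [apply Wst_sound|easy].
Qed.

Lemma eval_det c x y z : eval c x y -> eval c x z -> y = z.
Proof.
  revert x y z. induction c as [| | | | |f IHf g IHg|f IHf g IHg|f IHf g IHg|f IHf];
    intros x y z H1 H2.
  1-3: inversion H1; inversion H2; congruence.
  1-2: inversion H1; inversion H2; subst;
    match goal with E : cpair _ _ = cpair _ _ |- _ => now apply cpair_inj in E end.
  - inversion H1 as [| | | | |? ? ? u ? Hu Hy| | | |]; subst.
    inversion H2 as [| | | | |? ? ? v ? Hv Hz| | | |]; subst.
    rewrite (IHg _ _ _ Hu Hv) in Hy. eauto.
  - inversion H1; inversion H2; subst. f_equal; eauto.
  - rewrite <- (cpair_pl_pr x) in *. revert y z H1 H2.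
    induction (pr x) as [|n IH]; intros y z H1 H2; inversion H1; inversion H2; subst;
      repeat match goal with
      | E : cpair _ _ = cpair _ _ |- _ => apply cpair_inj in E as [-> E]
      | E : S _ = S _ |- _ => injection E as ->
      end; try discriminate; [eauto|].
    match goal with
    | Hu : eval (PRec f g) _ ?u, Hv : eval (PRec f g) _ ?v,
      Hy : eval g _ y, Hz : eval g _ z |- _ =>
      assert (u = v) as -> by eauto
    end. eauto.
  - inversion H1 as [| | | | | | | | |? ? ? Hy Ly]; subst.
    inversion H2 as [| | | | | | | | |? ? ? Hz Lz]; subst.
    (* At the smaller of two distinct results [f] would yield both zero and a successor. *)
    destruct (lt_eq_lt_dec y z) as [[L| ]|L]; trivial; exfalso.
    + destruct (Lz _ L) as [k Hk]. discriminate (IHf _ _ _ Hy Hk).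
    + destruct (Ly _ L) as [k Hk]. discriminate (IHf _ _ _ Hz Hk).
Qed.

Fixpoint const_code (k : nat) : prc :=
  match k with 0 => PZero | S k => PComp PSucc (const_code k) end.

Lemma eval_const_code k x : eval (const_code k) x k.
Proof. induction k; simpl; repeat econstructor; eassumption. Qed.

Lemma tc_encode_const_code : tc (fun k => encode (const_code k)).
Proof.
  apply (tc_ext (fun k =>
    natrec (cpair 0 0) (fun _ r => cpair 5 (cpair (cpair 1 0) r)) k)); [solve_tc|].
  intro k. induction k as [|k IH]; [reflexivity|]. now rewrite natrec_S, IH.
Qed.

(* The s-m-n theorem for projections of decidable relations. *)
Lemma uniformly_ce (D : nat -> nat -> nat -> bool) :
  dec (fun u => D (pl (pl u)) (pr (pl u)) (pr u)) ->
  exists g, tc g /\ forall e z, W (g e) z <-> exists s, D e z s = true.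
Proof.
  (* [PMu] searches for the value 0, so truth of [D] has to be represented by 0. *)
  intros [c Hc]%dec_negb.
  exists (fun e => encode (PComp (PMu c) (PPair (const_code e) PId))). split.
  { pose proof tc_encode_const_code. simpl encode. solve_tc. }
  intros e z.
  assert (Hc' : forall s, eval c (cpair (cpair e z) s) (Nat.b2n (negb (D e z s)))).
  { intro s. specialize (Hc (cpair (cpair e z) s)). now unpair. }
  assert (Hz : eval (PPair (const_code e) PId) z (cpair e z)).
  { constructor; [apply eval_const_code|constructor]. }
  split.
  - intros [n H]. apply phi_encode in H.
    inversion H as [| | | | |? ? ? u ? Hu Hn| | | |]; subst.
    rewrite (eval_det _ _ _ _ Hu Hz) in Hn.
    inversion Hn as [| | | | | | | | |? ? ? H0 _]; subst.
    exists n. pose proof (eval_det _ _ _ _ H0 (Hc' n)).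
    now destruct (D e z n).
  - intros H.
    destruct (dec_inh_nat_subset_has_unique_least_element (fun s => D e z s = true))
      as (n & [Hn Hmin] & _); trivial.
    { intro s. destruct (D e z s); auto. }
    exists n. apply phi_encode, ev_comp with (cpair e z); trivial.
    constructor.
    + specialize (Hc' n). now rewrite Hn in Hc'.
    + intros m Hm. exists 0. specialize (Hc' m).
      destruct (D e z m) eqn:E; trivial. apply Hmin in E. lia.
Qed.

(** * Counting *)

Lemma count_below_mono A n m : n <= m -> count_below A n <= count_below A m.
Proof. induction 1; simpl; lia. Qed.

Lemma count_below_add_le A n k : count_below A (n + k) <= count_below A n + k.
Proof.
  induction k as [|k IH]; [rewrite Nat.add_0_r; lia|].
  rewrite Nat.add_succ_r. simpl. destruct (excluded_middle_informative _); lia.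
Qed.

Lemma count_below_le A n : count_below A n <= n.
Proof. apply (count_below_add_le A 0 n). Qed.

Lemma count_below_add_full A n k :
  (forall x, n <= x < n + k -> A x) -> count_below A (n + k) = count_below A n + k.
Proof.
  induction k as [|k IH]; intro H; [now rewrite !Nat.add_0_r|].
  rewrite !Nat.add_succ_r. simpl. rewrite IH by (intros; apply H; lia).
  destruct (excluded_middle_informative _) as [|C]; [lia|].
  exfalso. apply C, H. lia.
Qed.

Lemma count_below_add_empty A n k :
  (forall x, n <= x < n + k -> ~ A x) -> count_below A (n + k) = count_below A n.
Proof.
  induction k as [|k IH]; intro H; [now rewrite !Nat.add_0_r|].
  rewrite !Nat.add_succ_r. simpl. rewrite IH by (intros; apply H; lia).
  destruct (excluded_middle_informative _) as [C|]; [|lia].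
  exfalso. apply (H (n + k)); trivial. lia.
Qed.

Lemma count_below_cover A B C n :
  (forall x, A x -> B x \/ C x) ->
  count_below A n <= count_below B n + count_below C n.
Proof.
  intro H. induction n as [|n IH]; simpl; [lia|]. specialize (H n).
  repeat destruct (excluded_middle_informative _); (lia || tauto).
Qed.

Lemma count_below_lt A N n : (forall x, A x -> x < N) -> count_below A n <= N.
Proof.
  intro H. destruct (Nat.le_ge_cases n N) as [L|L].
  - pose proof (count_below_le A n). lia.
  - replace n with (N + (n - N)) by lia. rewrite count_below_add_empty.
    + apply count_below_le.
    + intros x Hx C. apply H in C. lia.
Qed.

Definition cnt (i j n : nat) : nat := count_below (symdiff (W i) (W j)) n.

Lemma cnt_refl i n : cnt i i n = 0.
Proof.
  unfold cnt. apply (count_below_add_empty _ 0 n). unfold symdiff. tauto.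
Qed.

Lemma cnt_triangle i j k n : cnt i k n <= cnt i j n + cnt j k n.
Proof.
  apply count_below_cover. intro x. unfold symdiff.
  destruct (classic (W j x)); tauto.
Qed.

Lemma cnt_sym i j n : cnt i j n = cnt j i n.
Proof.
  unfold cnt. induction n as [|n IH]; simpl; [reflexivity|]. rewrite IH. unfold symdiff.
  do 2 destruct (excluded_middle_informative _); (lia || tauto).
Qed.

(** This form of density zero keeps all later estimates within the natural numbers. *)
Lemma Z0ce_iff i j :
  Z0ce i j <-> forall k, eventually (fun n => k * cnt i j n <= n).
Proof.
  unfold Z0ce. fold (cnt i j). split.
  (* [S k] avoids inverting zero, and [S N] below keeps the denominator [n] positive. *)
  - intros H k. destruct (H (/ INR (S k))%R) as [N HN].
    { apply Rinv_0_lt_compat, lt_0_INR. lia. }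
    exists (S N). intros n Hn. specialize (HN n ltac:(lia)).
    unfold Rdist in HN. rewrite Rminus_0_r in HN.
    apply (Rle_lt_trans _ _ _ (Rle_abs _)) in HN.
    assert (Pn : (0 < INR n)%R) by (apply lt_0_INR; lia).
    assert (Pk : (0 < INR (S k))%R) by (apply lt_0_INR; lia).
    fold (cnt i j n) in HN.
    apply INR_le. rewrite mult_INR.
    assert (E : (INR (S k) * INR (cnt i j n) < INR n)%R).
    { apply (Rmult_lt_compat_r (INR n * INR (S k))) in HN; [|nra].
      field_simplify in HN; [|lra|lra]. lra. }
    pose proof (pos_INR (cnt i j n)). rewrite S_INR in E. lra.
  - intros H eps Heps. destruct (archimed_cor1 eps Heps) as (k & Hk & Pk).
    destruct (H k) as [N HN]. exists (S N). intros n Hn.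
    specialize (HN n ltac:(lia)). unfold Rdist. rewrite Rminus_0_r.
    fold (cnt i j n).
    assert (Pn : (0 < INR n)%R) by (apply lt_0_INR; lia).
    apply lt_0_INR in Pk. apply le_INR in HN. rewrite mult_INR in HN.
    pose proof (pos_INR (cnt i j n)) as Pc.
    rewrite Rabs_pos_eq.
    + apply Rle_lt_trans with (2 := Hk). apply Rmult_le_reg_r with (INR n * INR k)%R; [nra|].
      field_simplify; lra.
    + apply Rmult_le_pos; trivial. left. now apply Rinv_0_lt_compat.
Qed.

(** * Reducing almost-equality of columns to density *)

(* [block y = cpair m n] says that [y] lies in [[2^m, 2^(m+1))] and, unless
   [y - 2^m] is tiny, that [y - 2^m] lies in [[2^(m-n-1), 2^(m-n))]. *)
Definition block (y : nat) : nat :=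
  let m := Nat.log2 y in cpair m (pred m - Nat.log2 (y - 2 ^ m)).

Lemma pr_block_ge N y :
  S N <= pr (block y) ->
  y < 2 ^ Nat.log2 y + 2 ^ (Nat.log2 y - S N) /\ S N < Nat.log2 y.
Proof.
  unfold block. unpair. set (m := Nat.log2 y). intro H. split; [|lia].
  (* [Nat.log2] sends 0 to 0, but its specification covers only positive offsets. *)
  destruct (Nat.eq_dec (y - 2 ^ m) 0) as [E|E].
  - pose proof (Nat.pow_nonzero 2 (m - S N)). lia.
  - pose proof (Nat.log2_spec (y - 2 ^ m) ltac:(lia)) as [_ L].
    pose proof (Nat.pow_le_mono_r 2 (S (Nat.log2 (y - 2 ^ m))) (m - S N)). lia.
Qed.

Lemma block_interval m n y :
  n < m -> 2 ^ m + 2 ^ (m - S n) <= y < 2 ^ m + 2 ^ (m - S n) + 2 ^ (m - S n) ->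
  block y = cpair m n.
Proof.
  intros Hn Hy.
  assert (Hm : 2 ^ m >= 2 ^ (m - S n) + 2 ^ (m - S n)).
  { replace m with (S (m - S n) + n) at 1 by lia. rewrite Nat.pow_add_r.
    pose proof (Nat.pow_nonzero 2 n). simpl. nia. }
  assert (E : Nat.log2 y = m).
  { apply Nat.log2_unique; [lia|]. simpl. lia. }
  assert (E' : Nat.log2 (y - 2 ^ m) = m - S n).
  { apply Nat.log2_unique; [lia|]. simpl. lia. }
  unfold block. cbv zeta. rewrite E, E'. f_equal. lia.
Qed.

(** Within [[2^m, 2^(m+1))] such points occupy at most the first [2^(m - S N)] places, a proportion
    [2^-(S N)]. Rounding [n] up to a power of two costs the factor 2; the additive constant absorbs
    the crude bound that starts the induction. *)
Lemma count_small_blocks N n :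
  2 ^ S N * count_below (fun y => S N <= pr (block y)) n <= 2 * n + 2 ^ S N * 2 ^ S N.
Proof.
  set (A := fun y => S N <= pr (block y)).
  assert (H : forall m, 2 ^ S N * count_below A (2 ^ m) <= 2 ^ m + 2 ^ S N * 2 ^ S N).
  { induction m as [|m IH].
    - pose proof (count_below_le A (2 ^ 0)). simpl (2 ^ 0) in *.
      pose proof (Nat.pow_nonzero 2 (S N)). nia.
    - replace (2 ^ S m) with (2 ^ m + 2 ^ m) by (simpl; lia).
      destruct (Nat.le_gt_cases m (S N)) as [L|L].
      + rewrite (count_below_add_empty A).
        * lia.
        * intros x Hx HA. apply pr_block_ge in HA as [_ HA].
          rewrite (Nat.log2_unique x m) in HA; simpl; lia.
      + replace (2 ^ m + 2 ^ m) with
          (2 ^ m + 2 ^ (m - S N) + (2 ^ m - 2 ^ (m - S N))) at 1.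
        2: { pose proof (Nat.pow_le_mono_r 2 (m - S N) m). lia. }
        rewrite (count_below_add_empty A).
        * pose proof (count_below_add_le A (2 ^ m) (2 ^ (m - S N))).
          assert (2 ^ S N * 2 ^ (m - S N) = 2 ^ m).
          { rewrite <- Nat.pow_add_r. f_equal. lia. }
          nia.
        * intros x Hx HA. apply pr_block_ge in HA as [HA _].
          rewrite (Nat.log2_unique x m) in HA; simpl; lia. }
  destruct n as [|n]; [simpl; lia|].
  pose proof (Nat.log2_spec (S n) ltac:(lia)) as [L1 L2].
  pose proof (count_below_mono A _ _ (Nat.lt_le_incl _ _ L2)).
  specialize (H (S (Nat.log2 (S n)))).
  assert (2 ^ S (Nat.log2 (S n)) = 2 * 2 ^ Nat.log2 (S n)) by reflexivity.
  nia.
Qed.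

Lemma finite_columns_bound (A : nat -> nat -> Prop) N :
  (forall n, finite_set (A n)) -> exists B, forall n x, n < N -> A n x -> x < B.
Proof.
  intro H. induction N as [|N [B IH]].
  - exists 0. lia.
  - destruct (H N) as [C HC]. exists (B + C). intros n x Hn Hx.
    destruct (Nat.eq_dec n N) as [->|].
    + apply HC in Hx. lia.
    + apply IH in Hx; lia.
Qed.

Lemma E3ce_le_Z0ce : creducible E3ce Z0ce.
Proof.
  destruct (uniformly_ce (fun e z s => Wst e (block z) s)) as (g & Hg & HW).
  { unfold block. solve_tc. }
  assert (HW' : forall e z, W (g e) z <-> W e (block z)).
  { intros e z. rewrite HW. split.
    - intros [s H]. now apply Wst_sound in H.
    - intro H. destruct (Wst_limit e (block z)) as [s Hs]. exists s. now apply Hs. }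
  exists g. split; [exact Hg|]. intros i j.
  assert (HS : forall z, symdiff (W (g i)) (W (g j)) z
                         <-> symdiff (W i) (W j) (block z)).
  { intro z. unfold symdiff. now rewrite !HW'. }
  rewrite Z0ce_iff. split.
  (* With this [N], [4 * k <= 2 ^ N]. The columns from [N] on contribute at most [2 * n] to [2 ^ N]
     times the count, and the constants at most another [n]. *)
  - intros H k. set (N := S (S k)).
    destruct (finite_columns_bound
      (fun n x => symdiff (W i) (W j) (cpair x n)) N) as [B HB].
    { exact H. }
    (* A difference in one of the first [N] columns has first coordinate [Nat.log2 y < B], so [y] is
       bounded. *)
    assert (Hcnt : forall n, cnt (g i) (g j) n <=
              2 ^ S B + count_below (fun y => N <= pr (block y)) n).
    { intro n.
      pose proof (count_below_lt (fun y => y < 2 ^ S B) (2 ^ S B) n (fun _ L => L)).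
      enough (cnt (g i) (g j) n <= count_below (fun y => y < 2 ^ S B) n
                + count_below (fun y => N <= pr (block y)) n) by lia.
      apply count_below_cover. intros y Hy.
      destruct (Nat.le_gt_cases N (pr (block y))) as [L|L]; [now right|left].
      apply HS in Hy. rewrite <- (cpair_pl_pr (block y)) in Hy.
      apply HB in Hy; trivial. unfold block in Hy. unpair.
      destruct y as [|y]; [pose proof (Nat.pow_nonzero 2 (S B)); lia|].
      apply Nat.log2_lt_pow2; lia. }
    exists (2 ^ N * 2 ^ S B + 2 ^ N * 2 ^ N). intros n Hn. specialize (Hcnt n).
    pose proof (count_small_blocks (S k) n) as Hsm. fold N in Hsm.
    assert (HN : 4 * k <= 2 ^ N).
    { unfold N. pose proof (Nat.pow_gt_lin_r 2 k). simpl. lia. }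
    nia.
  (* A difference at [cpair m n] fills a proportion [2^-(n+2)] of the numbers below [2 ^ S m], twice
     what this constant permits. *)
  - intros H n. destruct (H (8 * 2 ^ n)) as [N HN].
    exists (N + S n). intros m Hm.
    destruct (Nat.le_gt_cases (N + S n) m) as [L|]; trivial. exfalso.
    specialize (HN (2 ^ S m)).
    pose proof (Nat.pow_gt_lin_r 2 (S m) ltac:(lia)) as G.
    specialize (HN ltac:(lia)).
    assert (Hs : 2 ^ n * 2 ^ (m - S n) * 2 = 2 ^ m).
    { rewrite Nat.mul_comm, <- Nat.pow_add_r, <- Nat.pow_succ_r'. f_equal. lia. }
    assert (Hc : 2 ^ (m - S n) <= cnt (g i) (g j) (2 ^ S m)).
    { unfold cnt. set (a := 2 ^ m + 2 ^ (m - S n)).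
      transitivity (count_below (symdiff (W (g i)) (W (g j))) (a + 2 ^ (m - S n))).
      - rewrite count_below_add_full; [lia|]. intros y Hy. apply HS.
        rewrite (block_interval m n y); [exact Hm|lia|exact Hy].
      - apply count_below_mono. unfold a. pose proof (Nat.pow_nonzero 2 n).
        simpl. nia. }
    pose proof (Nat.pow_nonzero 2 m).
    assert (2 ^ S m = 2 * 2 ^ m) by reflexivity. nia.
Qed.

(** * Reducing density to almost-equality of columns *)

(** The threshold [N] is an explicit argument, which leaves a Pi_2 condition; quantifying over it
    gives the Sigma_3 edge relation. *)
Definition close (r b c N : nat) : Prop :=
  forall n, N <= n -> 2 ^ (r + b + c) * cnt b c n <= n.

Lemma close_sym r b c N : close r b c N -> close r c b N.
Proof.
  intros H n Hn. rewrite cnt_sym.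
  replace (r + c + b) with (r + b + c) by lia. now apply H.
Qed.

(** Vertices are confined to a list so that a vertex, once left, can be deleted from it. *)
Inductive walk (r : nat) (S : list nat) : nat -> nat -> Prop :=
| walk_refl b : In b S -> walk r S b b
| walk_step b b' c N :
    In b S -> close r b b' N -> walk r S b' c -> walk r S b c.

Lemma walk_start r S b c : walk r S b c -> In b S.
Proof. now destruct 1. Qed.

Lemma walk_incl r S S' b c : incl S S' -> walk r S b c -> walk r S' b c.
Proof. intro H. induction 1; econstructor; eauto. Qed.

(** If the walk meets [v], cut it at the last visit: either it ends there, or the rest after the
    next edge avoids [v]. *)
Lemma walk_avoid r S v x c :
  walk r S x c ->
  walk r (remove Nat.eq_dec v S) x c \/
  v = c \/ exists v' N, close r v v' N /\ walk r (remove Nat.eq_dec v S) v' c.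
Proof.
  induction 1 as [b Hb|b b' c N Hb HN _ IH].
  - destruct (Nat.eq_dec v b) as [|n]; [now right; left|left].
    constructor. now apply in_in_remove; [congruence|].
  - destruct IH as [IH|IH]; [|now right].
    destruct (Nat.eq_dec v b) as [->|n].
    + right; right. eauto.
    + left. econstructor; [|eassumption|exact IH].
      apply in_in_remove; [congruence|trivial].
Qed.

(** For vertices below [L] this is the sum of the [2^-v], scaled by [2^L] to remain integral. *)
Definition weight (L : nat) (S : list nat) : nat :=
  list_sum (map (fun v => 2 ^ (L - v)) S).

Lemma weight_remove L v S :
  In v S -> weight L (remove Nat.eq_dec v S) + 2 ^ (L - v) <= weight L S.
Proof.
  unfold weight. induction S as [|a S IH]; [easy|]. intro H. simpl.
  destruct (Nat.eq_dec v a) as [->|n].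
  - destruct (in_dec Nat.eq_dec a S) as [Ha|Ha].
    + apply IH in Ha. lia.
    + rewrite notin_remove by exact Ha. lia.
  - destruct H as [H|H]; [congruence|]. apply IH in H. simpl. lia.
Qed.

(* Each vertex is left only once, so the walk may be taken without repetitions
   and its length is dominated by a geometric series. *)
Lemma walk_cnt r L S b c :
  (forall v, In v S -> v < L) -> walk r S b c ->
  eventually (fun n => 2 ^ (r + L) * cnt b c n <= n * weight L S).
Proof.
  remember (length S) as k eqn:Hk. revert S b Hk.
  induction k as [k IH] using lt_wf_ind. intros S b -> HL Hw.
  pose proof (walk_start _ _ _ _ Hw) as Hb.
  destruct (walk_avoid r S b b c Hw) as [H|[->|(b' & N & HN & H)]].
  - exfalso. apply walk_start in H. now apply remove_In in H.
  - exists 0. intros n _. rewrite cnt_refl. lia.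
  - apply IH with (m := length (remove Nat.eq_dec b S)) in H; trivial.
    + generalize (eventually_and _ _ (eventually_ge N) H). apply eventually_impl.
      intros n [Hn Hc]. apply HN in Hn.
      pose proof (cnt_triangle b b' c n).
      pose proof (weight_remove L b S Hb).
      (* The first edge is charged to its source [b] alone, whose share of the weight is
         [2 ^ (L - b)]. *)
      assert (2 ^ (r + L) * cnt b b' n <= n * 2 ^ (L - b)).
      { specialize (HL b Hb).
        replace (r + L) with (r + b + (L - b)) by lia. rewrite Nat.pow_add_r.
        assert (2 ^ (r + b) <= 2 ^ (r + b + b')) by (apply Nat.pow_le_mono_r; lia).
        assert (2 ^ (r + b) * cnt b b' n <= n) by nia.
        rewrite <- Nat.mul_assoc, (Nat.mul_comm (2 ^ (L - b))), Nat.mul_assoc.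
        now apply Nat.mul_le_mono_r. }
      nia.
    + now apply remove_length_lt.
    + intros v Hv. apply in_remove in Hv as [Hv _]. auto.
Qed.

Lemma weight_seq L : weight L (seq 0 L) <= 2 * 2 ^ L.
Proof.
  (* The extra term is the unspent remainder of the geometric series, which makes the induction go
     through. *)
  enough (H : forall k, k <= L -> weight L (seq 0 k) + 2 * 2 ^ (L - k) <= 2 * 2 ^ L)
    by (specialize (H L (Nat.le_refl L)); lia).
  induction k as [|k IH]; intro Hk.
  - rewrite Nat.sub_0_r. unfold weight. simpl. lia.
  - rewrite seq_S. unfold weight in *. rewrite map_app, list_sum_app. simpl.
    specialize (IH ltac:(lia)). replace (L - k) with (S (L - S k)) in * by lia.
    simpl in *. lia.
Qed.

Definition connected (r b c : nat) : Prop := exists L, walk r (seq 0 L) b c.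

Lemma connected_refl r b : connected r b b.
Proof. exists (S b). constructor. apply in_seq. lia. Qed.

Lemma connected_step r b b' c N :
  close r b b' N -> connected r b' c -> connected r b c.
Proof.
  intros H [L HL]. exists (L + S b). econstructor; [|exact H|].
  - apply in_seq. lia.
  - revert HL. apply walk_incl. intros v. rewrite !in_seq. lia.
Qed.

(** The factor [2 ^ L] cancels against the weight, so the bound does not depend on how far the walk
    strays. *)
Lemma connected_cnt r b c :
  connected r b c -> eventually (fun n => 2 ^ r * cnt b c n <= 2 * n).
Proof.
  intros [L HL]. generalize (walk_cnt r L (seq 0 L) b c ltac:(intro v; rewrite in_seq; lia) HL).
  apply eventually_impl. intros n H. pose proof (weight_seq L) as H0.
  rewrite Nat.pow_add_r in H. pose proof (Nat.pow_nonzero 2 L).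
  apply Nat.mul_le_mono_pos_l with (2 ^ L); [lia|].
  apply Nat.mul_le_mono_l with (p := n) in H0. lia.
Qed.

(** * Stage approximations to closeness *)

Definition scount (b c n s : nat) : nat :=
  natrec 0 (fun x r => r + Nat.b2n (xorb (Wst b x s) (Wst c x s))) n.

Lemma scount_limit b c n : eventually (fun s => scount b c n s = cnt b c n).
Proof.
  induction n as [|n IH]; [now exists 0|].
  generalize (eventually_and _ _ IH
    (eventually_and _ _ (Wst_limit b n) (Wst_limit c n))).
  apply eventually_impl. intros s (H & Hb & Hc).
  unfold scount. rewrite natrec_S. fold (scount b c n s). rewrite H.
  unfold cnt. simpl. f_equal. unfold symdiff.
  destruct (excluded_middle_informative _), (Wst b n s), (Wst c n s); simpl;
    trivial; exfalso; intuition discriminate.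
Qed.

(** The clause [t <= s] forces late stages as [t] grows, so that premature counts cannot confirm
    closeness at every level. *)
Definition near (r b c N t s : nat) : bool :=
  (t <=? s) &&
  ball (S t) (fun n => (n <? N) || (2 ^ (r + b + c) * scount b c n s <=? n)).

Lemma near_true r b c N t s :
  near r b c N t s = true <->
  t <= s /\ forall n, N <= n <= t -> 2 ^ (r + b + c) * scount b c n s <= n.
Proof.
  unfold near. rewrite andb_true_iff, Nat.leb_le, ball_true. split; intros [Ht H]; split;
    trivial; intros n Hn.
  - specialize (H n ltac:(lia)).
    apply orb_true_iff in H as [H|H]; [apply Nat.ltb_lt in H; lia|now apply Nat.leb_le].
  - apply orb_true_iff. rewrite Nat.ltb_lt, Nat.leb_le.
    destruct (Nat.le_gt_cases N n); [right; apply H|left]; lia.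
Qed.

Lemma near_anti r b c N t t' s :
  t' <= t -> near r b c N t s = true -> near r b c N t' s = true.
Proof.
  rewrite !near_true. intros L [Ht H]. split; [lia|]. intros n Hn. apply H. lia.
Qed.

Lemma close_iff_near r b c N :
  close r b c N <-> forall t, exists s, near r b c N t s = true.
Proof.
  split.
  - intros H t.
    assert (eventually (fun s => forall n, n < S t -> scount b c n s = cnt b c n))
      as [s Hs] by (apply eventually_forall_lt; intros; apply scount_limit).
    exists (s + t). apply near_true. split; [lia|]. intros n Hn.
    rewrite Hs by lia. apply H. lia.
  - intros H n Hn. destruct (scount_limit b c n) as [s0 Hs0].
    (* This level covers [n] and also pushes the stage past [s0], where the count at [n] is
       final. *)
    destruct (H (n + s0)) as [s Hs]. apply near_true in Hs as [Ht Hs].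
    rewrite <- (Hs0 s) by lia. apply Hs. lia.
Qed.

(* [p] codes a guess, by its bits below [log2 p], at a union of classes of
   [connected r]; it is refuted up to [t] by an approximation to a pair of
   close indices that [p] separates. *)
Definition refutes (r p t s : nat) : bool :=
  bex (Nat.log2 p) (fun b => bex (Nat.log2 p) (fun c => bex (Nat.log2 p) (fun N =>
    xorb (Nat.testbit p b) (Nat.testbit p c) && near r b c N t s))).

Lemma dec_refutes r p t s :
  tc r -> tc p -> tc t -> tc s -> dec (fun x => refutes (r x) (p x) (t x) (s x)).
Proof. intros. unfold refutes, near, scount. solve_tc. Qed.
#[local] Hint Resolve dec_refutes : tc.

Definition refuted (r p t : nat) : Prop := exists s, refutes r p t s = true.

Lemma refuted_iff r p t :
  refuted r p t <-> exists b c N s,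
    (b < Nat.log2 p /\ c < Nat.log2 p /\ N < Nat.log2 p) /\
    Nat.testbit p b <> Nat.testbit p c /\ near r b c N t s = true.
Proof.
  unfold refuted, refutes. split.
  - intros (s & H). apply bex_true in H as (b & Hb & H).
    apply bex_true in H as (c & Hc & H). apply bex_true in H as (N & HN & H).
    apply andb_true_iff in H as [Hx H]. exists b, c, N, s. repeat split; trivial.
    intro E. rewrite E, xorb_nilpotent in Hx. discriminate.
  - intros (b & c & N & s & (Hb & Hc & HN) & Hx & H). exists s.
    apply bex_true. exists b. split; trivial. apply bex_true. exists c. split; trivial.
    apply bex_true. exists N. split; trivial. rewrite H.
    destruct (Nat.testbit p b), (Nat.testbit p c); easy.
Qed.

Lemma refuted_anti r p t t' : t' <= t -> refuted r p t -> refuted r p t'.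
Proof.
  rewrite !refuted_iff. intros L (b & c & N & s & H1 & H2 & H3).
  exists b, c, N, s. repeat split; try apply H1; trivial. now apply (near_anti _ _ _ _ t).
Qed.

(* Column [r] of the set attached to [e]. For each guess [p] the images can differ
   only at the least [t] for which [p] is not refuted. *)
Definition image (e r p t : nat) : Prop :=
  refuted r p t \/ Nat.testbit p e = true /\ (t = 0 \/ refuted r p (pred t)).

Lemma image_ce :
  exists g, tc g /\ forall e r p t,
    column (W (g e)) r (cpair p t) <-> image e r p t.
Proof.
  destruct (uniformly_ce (fun e z s =>
    let r := pr z in let p := pl (pl z) in let t := pr (pl z) in
    refutes r p t s
    || Nat.testbit p e && ((t =? 0) || refutes r p (pred t) s))) as (g & Hg & HW).
  { cbv zeta. solve_tc. }
  exists g. split; [exact Hg|]. intros e r p t. unfold column. rewrite HW.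
  cbv zeta. unpair. unfold image, refuted. split.
  - intros (s & H). split_bool; eauto.
  - intros [[s H]|[H1 [->|[s H2]]]].
    + exists s. now rewrite H.
    + exists 0. rewrite H1. apply orb_true_r.
    + exists s. rewrite H1, H2, orb_true_r. apply orb_true_r.
Qed.

Lemma image_differ_unique e f r p t t' :
  symdiff (image e r p) (image f r p) t ->
  symdiff (image e r p) (image f r p) t' -> t = t'.
Proof.
  (* A difference can arise only at the boundary of the refuted levels, which form an initial
     segment by [refuted_anti]. *)
  assert (K : forall t, symdiff (image e r p) (image f r p) t ->
    ~ refuted r p t /\ (t = 0 \/ refuted r p (pred t)))
    by (unfold symdiff, image; tauto).
  intros [H1 H2]%K [H3 H4]%K.
  destruct (lt_eq_lt_dec t t') as [[L| ]|L]; trivial; exfalso.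
  - destruct H4 as [->|H4]; [lia|]. apply H1. apply (refuted_anti _ _ (pred t')); [lia|easy].
  - destruct H2 as [->|H2]; [lia|]. apply H3. apply (refuted_anti _ _ (pred t)); [lia|easy].
Qed.

(** A guess not separating [e] and [f] treats them alike; one that separates them is refuted at
    every level by their own edge, so both images are full. *)
Lemma close_image_eq e f r N p t :
  close r e f N -> e < Nat.log2 p -> f < Nat.log2 p -> N < Nat.log2 p ->
  ~ symdiff (image e r p) (image f r p) t.
Proof.
  intros Hc He Hf HN.
  destruct (bool_dec (Nat.testbit p e) (Nat.testbit p f)) as [E|E].
  - unfold symdiff, image. rewrite E. tauto.
  - assert (refuted r p t).
    { rewrite close_iff_near in Hc. destruct (Hc t) as [s Hs].
      apply refuted_iff. now exists e, f, N, s. }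
    unfold symdiff, image. tauto.
Qed.

(** The leading bit of [p] only marks the length [l]; the bits below it are free. *)
Lemma guess_exists (P : nat -> Prop) l :
  exists p, Nat.log2 p = l /\ forall i, i < l -> (Nat.testbit p i = true <-> P i).
Proof.
  enough (exists p, 0 < p /\ Nat.log2 p = l /\
            forall i, i < l -> (Nat.testbit p i = true <-> P i)) by firstorder.
  revert P. induction l as [|l IH]; intro P.
  - exists 1. repeat split; lia.
  - destruct (IH (fun i => P (S i))) as (p & Hp & Hl & HP).
    exists (2 * p + Nat.b2n (if excluded_middle_informative (P 0) then true else false)).
    repeat split; [lia| | |].
    + destruct (excluded_middle_informative (P 0)); simpl Nat.b2n.
      * now rewrite Nat.log2_succ_double, Hl.
      * now rewrite Nat.add_0_r, Nat.log2_double, Hl.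
    + destruct i as [|i].
      * rewrite Nat.testbit_0_r. now destruct (excluded_middle_informative (P 0)).
      * rewrite Nat.testbit_succ_r. apply HP. lia.
    + destruct i as [|i].
      * rewrite Nat.testbit_0_r. now destruct (excluded_middle_informative (P 0)).
      * rewrite Nat.testbit_succ_r. apply HP. lia.
Qed.

(** Only finitely many triples below [log2 p] can refute [p]. Each one that separates fails to be
    close, so its approximation dies at some level and stays dead. *)
Lemma eventually_not_refuted r p :
  (forall b c N, b < Nat.log2 p -> c < Nat.log2 p -> close r b c N ->
     Nat.testbit p b = Nat.testbit p c) ->
  eventually (fun t => ~ refuted r p t).
Proof.
  intro H. set (l := Nat.log2 p) in *.
  assert (K : eventually (fun t => forall b, b < l -> forall c, c < l ->
    forall N, N < l -> Nat.testbit p b <> Nat.testbit p c ->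
    forall s, near r b c N t s <> true)).
  { apply eventually_forall_lt; intros b Hb.
    apply eventually_forall_lt; intros c Hc.
    apply eventually_forall_lt; intros N _.
    destruct (classic (close r b c N)) as [C|C].
    - exists 0. intros t _ D. exfalso. eauto.
    - rewrite close_iff_near in C. apply not_all_ex_not in C as [t0 C].
      exists t0. intros t Ht _ s Hs. apply C. exists s. now apply (near_anti _ _ _ _ t). }
  revert K. apply eventually_impl. intros t K.
  rewrite refuted_iff. intros (b & c & N & s & (Hb & Hc & HN) & Hx & Hs).
  now apply (K b Hb c Hc N HN Hx s).
Qed.

(** The guess is the class of [e] cut off at [l]. No edge leaves the class, so a least unrefuted
    level exists, and it distinguishes the images. *)
Lemma not_connected_image_differ r e f l :
  ~ connected r f e -> e < l -> f < l ->
  exists p t, Nat.log2 p = l /\ image e r p t /\ ~ image f r p t.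
Proof.
  intros Hn He Hf.
  destruct (guess_exists (fun b => connected r b e) l) as (p & Hl & Hp).
  assert (H : eventually (fun t => ~ refuted r p t)).
  { apply eventually_not_refuted. rewrite Hl. intros b c N Hb Hc H.
    apply eq_true_iff_eq. rewrite !Hp by trivial.
    split; eapply connected_step; [apply close_sym|]; eassumption. }
  destruct H as [t0 H].
  destruct (dec_inh_nat_subset_has_unique_least_element (fun t => ~ refuted r p t))
    as (t & [Ht Hmin] & _).
  { intro t. apply classic. }
  { exists t0. now apply H. }
  exists p, t. split; [exact Hl|]. split.
  - right. split; [apply Hp; [trivial|apply connected_refl]|].
    destruct t as [|t]; [now left|right]. simpl. apply NNPP. intro C.
    apply Hmin in C. lia.
  - intros [C|[C _]]; [easy|]. now apply Hn, Hp.
Qed.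

Lemma Z0ce_le_E3ce : creducible Z0ce E3ce.
Proof.
  destruct image_ce as (g & Hg & HV). exists g. split; [exact Hg|]. intros e f.
  assert (HS : forall r p t,
    symdiff (column (W (g e)) r) (column (W (g f)) r) (cpair p t) <->
    symdiff (image e r p) (image f r p) t).
  { intros r p t. unfold symdiff. now rewrite !HV. }
  split.
  - intros H r. rewrite Z0ce_iff in H. destruct (H (2 ^ (r + e + f))) as [N HN].
    (* Larger guesses have [log2 p] above [e], [f] and [N], so [close_image_eq] applies; each of the
       finitely many others gives at most one difference. *)
    assert (K : exists B, forall p x, p < 2 ^ S (e + f + N) ->
      (exists t, x = cpair p t /\ symdiff (image e r p) (image f r p) t) -> x < B).
    { apply finite_columns_bound. intro p.
      destruct (classic (exists t, symdiff (image e r p) (image f r p) t)) as [[t Ht]|C].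
      - exists (S (cpair p t)). intros x (t' & -> & Ht').
        rewrite (image_differ_unique _ _ _ _ _ _ Ht Ht'). lia.
      - exists 0. intros x (t & _ & Ht). exfalso. eauto. }
    destruct K as [B HB]. exists B. intros x Hx.
    rewrite <- (cpair_pl_pr x), HS in Hx.
    apply (HB (pl x)).
    + apply NNPP. intro C.
      assert (S (e + f + N) <= Nat.log2 (pl x)).
      { pose proof (Nat.pow_nonzero 2 (S (e + f + N))).
        apply Nat.log2_le_pow2; lia. }
      revert Hx. apply (close_image_eq _ _ _ N); [exact HN|lia|lia|lia].
    + exists (pr x). now rewrite cpair_pl_pr.
  - intro H. apply Z0ce_iff. intro k.
    (* Level [S k] compensates the factor 2 in [connected_cnt], and [k < 2 ^ k] does the rest. *)
    assert (C : connected (S k) f e).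
    { apply NNPP. intro C. destruct (H (S k)) as [B HB].
      (* This length gives [B < log2 p <= p <= cpair p t], contradicting the bound [B] on
         differences. *)
      destruct (not_connected_image_differ (S k) e f (e + f + S B) C)
        as (p & t & Hl & H1 & H2); [lia|lia|].
      assert (L : cpair p t < B) by (apply HB, HS; now left).
      pose proof (cpair_ge p t). pose proof (Nat.log2_le_lin p). lia. }
    apply connected_cnt in C. revert C. apply eventually_impl. intros n C.
    rewrite cnt_sym. pose proof (Nat.pow_gt_lin_r 2 k). simpl in C. nia.
Qed.

Theorem theorem2p5 : creducible E3ce Z0ce /\ creducible Z0ce E3ce.
Proof. exact (conj E3ce_le_Z0ce Z0ce_le_E3ce). Qed.
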